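(* Let $\gamma>1$, $r_1>0$, $\rho_0>0$, $A_0>0$, $U_{10}<0$, $U_{20}\in\mathbb{R}$, with $U_{10}^2\ne \gamma A_0\rho_0^{\gamma-1}$. For $0<r_0<r_1$ consider Problem II on $\Omega=\{r_0<r<r_1\}$: find smooth $(U_1,U_2,\rho,A)(r)$ solving $$(\rho U_1)'+\tfrac1r\rho U_1=0,\quad U_1U_1'+\tfrac1\rho p'-\tfrac{U_2^2}{r}=0,\quad U_1U_2'+\tfrac{U_1U_2}{r}=0,\quad U_1A'=0,\qquad r_0<r<r_1,$$ with $p=A\rho^\gamma$ and $\rho(r_1)=\rho_0,\ U_1(r_1)=U_{10},\ U_2(r_1)=U_{20},\ A(r_1)=A_0$. Then there exists $r^\sharp<r_1$ (the limiting circle), depending only on $r_1,\gamma$ and the incoming flow state at $r_1$, such that the flow develops singularities as $r\to r^\sharp$ in the sense that if $r_0<r^\sharp$ there does not exist any global $C^1$-smooth solution to Problem II in $\Omega$. If $r_0\ge r^\sharp$, there exists a smooth solution to Problem II in $\Omega$, and the flow pattern is as follows. (1) If $M_1^2(r_1)>1$, or if $|\mathbf M|^2(r_1)>1>M_1^2(r_1)$, then there exists a unique smooth supersonic solution to Problem II in $\Omega$. (2) If $|\mathbf M|^2(r_1)<1$, then the constant $$r_c=\sqrt{\frac{(\gamma+1)(\kappa_1^2+\kappa_2^2\rho_c^2)}{2(\gamma-1)B_0\rho_c^2}},$$ which depends only on $r_1,\gamma$ and the incoming flow, satisfies $0<r_c<r_1$, and (a) if $r_0>r_c$, there exists a unique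 smooth subsonic solution to Problem II in $\Omega$; (b) if $r_0<r_c$, there exists a unique smooth transonic solution to Problem II in $\Omega$; (c) if $r_0=r_c$, there exists a unique smooth subsonic-sonic solution to Problem II in $\Omega$, with sonic circle located at $r=r_c$.
   Context: Radially symmetric steady compressible Euler flow: velocity $\mathbf u=U_1(r)\mathbf e_r+U_2(r)\mathbf e_\theta$, density $\rho(r)>0$, pressure $p=A\rho^\gamma$ with $A(r)>0$ a function of the entropy. Sound speed $c^2=\gamma p/\rho=\gamma A\rho^{\gamma-1}$; $M_i^2=U_i^2/c^2$ $(i=1,2)$, $|\mathbf M|^2=M_1^2+M_2^2$. The flow is supersonic, sonic or subsonic at $r$ if $|\mathbf M|^2>1$, $=1$, $<1$ respectively at $r$; a sonic circle is a circle on which the flow is sonic. A solution is supersonic (subsonic) in $\Omega$ if it is so at every point of $\Omega$; transonic if it changes smoothly between subsonic and supersonic inside $\Omega$; subsonic-sonic if it is subsonic in $\Omega$ and sonic at the exit $r=r_0$. A smooth solution means functions that are $C^1$ on $(r_0,r_1)$, continuous on $[r_0,r_1]$, satisfying the system and the boundary conditions. (The cases (1) and (2) are understood with $r_0\ge r^\sharp$.) Constants: $\kappa_1=r_1\rho_0U_{10}$, $\kappa_2=r_1U_{20}$, $B_0=\frac12(U_{10}^2+U_{20}^2)+\frac{\gamma A_0}{\gamma-1}\rho_0^{\gamma-1}$, $\rho_c=\left(\frac{2(\gamma-1)B_0}{(\gamma+1)\gamma A_0}\right)^{1/(\gamma-1)}$. *)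

(* Defs.v *)
From Stdlib Require Import Reals.
From Coquelicot Require Import Coquelicot.
Open Scope R_scope.

(* Radial profiles are total functions on R; only their values on [r0, r1]
   matter, so flows are compared with [agree_on]. *)
Record flow := Flow {
  U1 : R -> R;
  U2 : R -> R;
  rho : R -> R;
  A : R -> R
}.

Definition pressure (gamma : R) (w : flow) (r : R) : R :=
  A w r * Rpower (rho w r) gamma.

Definition sound_speed_sq (gamma d a : R) : R :=
  gamma * a * Rpower d (gamma - 1).

Definition mach1_sq (gamma u1 d a : R) : R :=
  u1 ^ 2 / sound_speed_sq gamma d a.

Definition mach2_sq (gamma u2 d a : R) : R :=
  u2 ^ 2 / sound_speed_sq gamma d a.

Definition mach_sq (gamma u1 u2 d a : R) : R :=
  mach1_sq gamma u1 d a + mach2_sq gamma u2 d a.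

Definition flow_mach_sq (gamma : R) (w : flow) (r : R) : R :=
  mach_sq gamma (U1 w r) (U2 w r) (rho w r) (A w r).

Definition supersonic_at (gamma : R) (w : flow) (r : R) : Prop :=
  flow_mach_sq gamma w r > 1.

Definition sonic_at (gamma : R) (w : flow) (r : R) : Prop :=
  flow_mach_sq gamma w r = 1.

Definition subsonic_at (gamma : R) (w : flow) (r : R) : Prop :=
  flow_mach_sq gamma w r < 1.

Definition supersonic (gamma r0 r1 : R) (w : flow) : Prop :=
  forall r, r0 < r < r1 -> supersonic_at gamma w r.

Definition subsonic (gamma r0 r1 : R) (w : flow) : Prop :=
  forall r, r0 < r < r1 -> subsonic_at gamma w r.

(* Both regimes occur inside the annulus.  That the change between them is
   smooth is part of [smooth_solution]. *)
Definition transonic (gamma r0 r1 : R) (w : flow) : Prop :=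
  (exists r, r0 < r < r1 /\ subsonic_at gamma w r) /\
  (exists r, r0 < r < r1 /\ supersonic_at gamma w r).

Definition subsonic_sonic (gamma r0 r1 : R) (w : flow) : Prop :=
  subsonic gamma r0 r1 w /\ sonic_at gamma w r0.

(* C^1 on the open interval, continuous (one-sidedly at the endpoints) on the
   closed one; the derivative may blow up at an endpoint. *)
Definition smooth_on (r0 r1 : R) (f : R -> R) : Prop :=
  (forall r, r0 < r < r1 -> ex_derive f r /\ continuous (Derive f) r) /\
  continuous_on (fun r => r0 <= r <= r1) f.

Definition smooth_flow (r0 r1 : R) (w : flow) : Prop :=
  smooth_on r0 r1 (U1 w) /\ smooth_on r0 r1 (U2 w) /\
  smooth_on r0 r1 (rho w) /\ smooth_on r0 r1 (A w).

Definition steady_euler_at (gamma : R) (w : flow) (r : R) : Prop :=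
  Derive (fun s => rho w s * U1 w s) r + / r * (rho w r * U1 w r) = 0 /\
  U1 w r * Derive (U1 w) r + / rho w r * Derive (pressure gamma w) r
    - U2 w r ^ 2 / r = 0 /\
  U1 w r * Derive (U2 w) r + U1 w r * U2 w r / r = 0 /\
  U1 w r * Derive (A w) r = 0.

Definition smooth_solution (gamma r1 rho0 A0 U10 U20 r0 : R) (w : flow)
    : Prop :=
  smooth_flow r0 r1 w /\
  (forall r, r0 <= r <= r1 -> 0 < rho w r /\ 0 < A w r) /\
  (forall r, r0 < r < r1 -> steady_euler_at gamma w r) /\
  rho w r1 = rho0 /\ U1 w r1 = U10 /\ U2 w r1 = U20 /\ A w r1 = A0.

Definition agree_on (r0 r1 : R) (w w' : flow) : Prop :=
  forall r, r0 <= r <= r1 ->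
    U1 w r = U1 w' r /\ U2 w r = U2 w' r /\
    rho w r = rho w' r /\ A w r = A w' r.

Definition exists_unique_flow (r0 r1 : R) (P : flow -> Prop) : Prop :=
  exists w, P w /\ forall w', P w' -> agree_on r0 r1 w w'.

Definition kappa1 (r1 rho0 U10 : R) : R := r1 * rho0 * U10.

Definition kappa2 (r1 U20 : R) : R := r1 * U20.

Definition B0 (gamma rho0 A0 U10 U20 : R) : R :=
  / 2 * (U10 ^ 2 + U20 ^ 2)
  + gamma * A0 / (gamma - 1) * Rpower rho0 (gamma - 1).

Definition rho_c (gamma rho0 A0 U10 U20 : R) : R :=
  Rpower (2 * (gamma - 1) * B0 gamma rho0 A0 U10 U20
          / ((gamma + 1) * gamma * A0))
         (1 / (gamma - 1)).

Definition r_c (gamma r1 rho0 A0 U10 U20 : R) : R :=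
  let k1 := kappa1 r1 rho0 U10 in
  let k2 := kappa2 r1 U20 in
  let b := B0 gamma rho0 A0 U10 U20 in
  let d := rho_c gamma rho0 A0 U10 U20 in
  sqrt ((gamma + 1) * (k1 ^ 2 + k2 ^ 2 * d ^ 2)
        / (2 * (gamma - 1) * b * d ^ 2)).

(* Main.v *)
Require Import Defs.
From Stdlib Require Import Reals Lra Ranalysis5.
From Coquelicot Require Import Coquelicot.
Open Scope R_scope.

(** The Euler system has four first integrals along the radius: the mass flux
    [r * rho * U1], the swirl [r * U2], the entropy function [A], and the
    Bernoulli energy.  Since the mass flux is nonzero, so is [U1], and for
    smooth flows the system is equivalent to the conservation of these four
    quantities ([first_integrals], [reduced_flow_solves]).  Their values are
    fixed by the incoming state; [U1], [U2] and [A] are then explicit functions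
    of [r] and of the density, and Bernoulli's law, which depends on [r] only
    through [r ^ 2], can be solved for the radius: the density [d] occurs
    exactly at the radius whose square is [radius_sq q d]
    ([bernoulli_iff]).

    The derivative of [radius_sq] has the sign of [sonic_gap], which is a
    positive multiple of [c ^ 2 - U1 ^ 2] and is strictly increasing in the
    density.  It therefore vanishes at exactly one density [ds], and
    [radius_sq] decreases before [ds] and increases after it.  The limiting
    circle is [r_sharp ^ 2 = radius_sq q ds], the least radius that Bernoulli's
    law permits, so no solution reaches below it.  The assumption
    [M_1 ^ 2 <> 1] at the inflow says that [rho0 <> ds].  The branch
    of [radius_sq] through [rho0] is then invertible from [r1] down to
    [r_sharp], with a [C^1] inverse for radii above [r_sharp], which gives
    existence ([density_branch], [solution_exists]).  A continuous solution can
    change branch only where its density is [ds], that is on the limiting circle,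
    so it is determined by its incoming state ([solution_stays_on_branch],
    [solution_unique]).

    Under Bernoulli's law the total Mach number is a strictly decreasing
    function of the density alone, equal to [1] at [sonic_density q]
    ([flow_regime]), and [r_c] is the radius of that density ([r_c_sonic]).
    Moreover [ds <= sonic_density q], because [U1 ^ 2 <= c ^ 2] in a sonic flow.
    Below [ds] every flow is thus supersonic.  Above [ds] the
    density decreases as [r] decreases, so a flow that enters supersonic stays so
    and a flow that enters subsonic becomes sonic exactly at [r = r_c].  This
    yields the classification. *)

(** * Calculus on a closed interval *)

Definition clamp (lo hi x : R) : R := Rmax lo (Rmin hi x).

Lemma clamp_bounds lo hi x : lo <= hi -> lo <= clamp lo hi x <= hi.
Proof.
  intros Hlh; unfold clamp, Rmax, Rmin.
  destruct (Rle_dec hi x), (Rle_dec lo _); lra.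
Qed.

Lemma clamp_id lo hi x : lo <= x <= hi -> clamp lo hi x = x.
Proof.
  intros Hx; unfold clamp, Rmax, Rmin.
  destruct (Rle_dec hi x), (Rle_dec lo _); lra.
Qed.

Lemma clamp_le_add lo hi x y e :
  Rabs (y - x) < e -> clamp lo hi y < clamp lo hi x + e.
Proof.
  intros H; apply Rabs_lt_between in H; unfold clamp, Rmax, Rmin.
  destruct (Rle_dec hi x), (Rle_dec hi y); repeat destruct (Rle_dec lo _); lra.
Qed.

Lemma clamp_contracts lo hi x y e :
  Rabs (y - x) < e -> Rabs (clamp lo hi y - clamp lo hi x) < e.
Proof.
  intros H.
  assert (H1 := clamp_le_add lo hi x y e H).
  rewrite Rabs_minus_sym in H.
  assert (H2 := clamp_le_add lo hi y x e H).
  apply Rabs_def1; lra.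
Qed.

(** Turns one-sided continuity at the endpoints into two-sided continuity, which
    is what the mean value and intermediate value theorems ask for. *)
Lemma continuous_clamped lo hi (f : R -> R) :
  lo <= hi -> continuous_on (fun x => lo <= x <= hi) f ->
  forall x, continuous (fun y => f (clamp lo hi y)) x.
Proof.
  intros Hlh Hf x.
  apply (filterlim_comp _ _ _ (clamp lo hi) f _
           (within (fun y => lo <= y <= hi) (locally (clamp lo hi x)))).
  - intros P [e He]; exists e; intros y Hy.
    apply He; [ apply clamp_contracts; exact Hy | apply clamp_bounds, Hlh ].
  - apply Hf, clamp_bounds, Hlh.
Qed.

Lemma continuous_on_plus (D : R -> Prop) (f g : R -> R) :
  continuous_on D f -> continuous_on D g ->
  continuous_on D (fun x => f x + g x).
Proof.
  intros Hf Hg x Hx.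
  exact (filterlim_comp_2 _ _ _ (Hf x Hx) (Hg x Hx) (filterlim_plus (f x) (g x))).
Qed.

Lemma continuous_on_mult (D : R -> Prop) (f g : R -> R) :
  continuous_on D f -> continuous_on D g ->
  continuous_on D (fun x => f x * g x).
Proof.
  intros Hf Hg x Hx.
  exact (filterlim_comp_2 _ _ _ (Hf x Hx) (Hg x Hx) (filterlim_mult (f x) (g x))).
Qed.

Lemma continuous_on_comp (D : R -> Prop) (f g : R -> R) :
  continuous_on D f -> (forall x, D x -> continuous g (f x)) ->
  continuous_on D (fun x => g (f x)).
Proof.
  intros Hf Hg x Hx.
  exact (filterlim_comp _ _ _ f g _ _ _ (Hf x Hx) (Hg x Hx)).
Qed.

(** The mean value theorem for the clamped function: the derivative is only known
    inside the interval, as it may blow up at an endpoint. *)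
Lemma constant_on_closed a b (f : R -> R) :
  a < b -> continuous_on (fun x => a <= x <= b) f ->
  (forall x, a < x < b -> is_derive f x 0) ->
  forall x, a <= x <= b -> f x = f b.
Proof.
  intros Hab Hc Hd x Hx.
  pose (F := fun y => f (clamp a b y)).
  destruct (MVT_gen F x b (fun _ => 0)) as [c [_ Hv]].
  - intros y Hy; rewrite Rmin_left, Rmax_right in Hy by lra.
    apply is_derive_ext_loc with f; [ | apply Hd; lra ].
    apply (locally_interval _ y a b); simpl; try lra.
    intros z H1 H2; unfold F; rewrite clamp_id; simpl in *; lra.
  - intros y _; apply continuity_pt_filterlim.
    apply (continuous_clamped a b f); [ lra | exact Hc ].
  - unfold F in Hv; rewrite !clamp_id in Hv by lra; lra.
Qed.

(** Strict monotonicity alone makes the inverse continuous: if [f (g y) = y], a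
    value [y'] below [f (g y + eps)] has [g y' < g y + eps].  Clamping the
    argument makes the inverse continuous on the whole line, so that a density
    built from it needs no separate treatment at the ends of the annulus. *)
Lemma continuous_increasing_inverse a b (f : R -> R) :
  a < b -> (forall x, a <= x <= b -> continuous f x) ->
  (forall x y, a <= x -> x < y -> y <= b -> f x < f y) ->
  exists g : R -> R, (forall y, continuous g y) /\
    forall y, a <= g y <= b /\ f (g y) = clamp (f a) (f b) y.
Proof.
  intros Hab Hc Hi.
  assert (Hfab : f a < f b) by (apply Hi; lra).
  assert (Hv : forall y, {x | a <= x <= b /\ f x = clamp (f a) (f b) y}).
  { intros y; apply f_interv_is_interv; [ exact Hab | apply clamp_bounds; lra | ].
    intros x Hx; apply continuity_pt_filterlim, Hc, Hx. }
  exists (fun y => proj1_sig (Hv y)); split.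
  2: intros y; exact (proj2_sig (Hv y)).
  intros y.
  destruct (proj2_sig (Hv y)) as [Hb He].
  set (t := proj1_sig (Hv y)) in *.
  assert (Hlift : forall x x', a <= x <= b -> a <= x' <= b -> f x < f x' -> x < x').
  { intros x x' Hx Hx' Hlt; destruct (Rlt_or_le x x') as [|[Hgt|Heq]]; [ easy | | ].
    - assert (f x' < f x) by (apply Hi; lra); lra.
    - subst; lra. }
  apply filterlim_locally; intros eps; destruct eps as [eps Heps].
  assert (Hup : exists d, 0 < d /\
            forall z, Rabs (z - y) < d -> proj1_sig (Hv z) < t + eps).
  { destruct (Rle_or_lt (t + eps) b) as [Hle|Hgt].
    - exists (f (t + eps) - f t); split.
      + assert (f t < f (t + eps)) by (apply Hi; lra); lra.
      + intros z Hz; destruct (proj2_sig (Hv z)) as [Hzb Hze].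
        apply Hlift; [ easy | lra | ].
        rewrite Hze; apply (clamp_le_add (f a) (f b)) in Hz; lra.
    - exists 1; split; [ lra | ].
      intros z _; destruct (proj2_sig (Hv z)); lra. }
  assert (Hlo : exists d, 0 < d /\
            forall z, Rabs (z - y) < d -> t - eps < proj1_sig (Hv z)).
  { destruct (Rle_or_lt a (t - eps)) as [Hle|Hgt].
    - exists (f t - f (t - eps)); split.
      + assert (f (t - eps) < f t) by (apply Hi; lra); lra.
      + intros z Hz; destruct (proj2_sig (Hv z)) as [Hzb Hze].
        apply Hlift; [ lra | easy | ].
        rewrite Hze; rewrite Rabs_minus_sym in Hz.
        apply (clamp_le_add (f a) (f b)) in Hz; lra.
    - exists 1; split; [ lra | ].
      intros z _; destruct (proj2_sig (Hv z)); lra. }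
  destruct Hup as [d1 [Hd1 Hup]], Hlo as [d2 [Hd2 Hlo]].
  exists (mkposreal _ (Rmin_pos d1 d2 Hd1 Hd2)); intros z Hz.
  change (Rabs (z - y) < Rmin d1 d2) in Hz.
  change (Rabs (proj1_sig (Hv z) - t) < eps).
  assert (Rabs (z - y) < d1) as H1 by (eapply Rlt_le_trans; [ apply Hz | apply Rmin_l ]).
  assert (Rabs (z - y) < d2) as H2 by (eapply Rlt_le_trans; [ apply Hz | apply Rmin_r ]).
  apply Hup in H1; apply Hlo in H2; apply Rabs_def1; lra.
Qed.

(** Caratheodory's argument: the difference quotient of [g] is the inverse of the
    slope function of [f] composed with [g], and that slope function is
    continuous at [g y] with value [l]. *)
Lemma is_derive_continuous_inverse (f g : R -> R) y l :
  l <> 0 -> is_derive f (g y) l -> continuous g y ->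
  locally y (fun z => f (g z) = z) -> is_derive g y (/ l).
Proof.
  intros Hl Hf Hg Hfg.
  assert (Hy : f (g y) = y) by exact (locally_singleton _ _ Hfg).
  pose (slope := fun x =>
    if Req_EM_T x (g y) then l else (f x - f (g y)) / (x - g y)).
  assert (Hs0 : slope (g y) = l)
    by (unfold slope; destruct (Req_EM_T (g y) (g y)); congruence).
  assert (Hs : continuous slope (g y)).
  { apply is_derive_Reals in Hf.
    apply filterlim_locally; intros eps.
    destruct (Hf eps (cond_pos eps)) as [d Hd].
    exists d; intros x Hx; change (Rabs (slope x - slope (g y)) < eps).
    change (Rabs (x - g y) < d) in Hx.
    rewrite Hs0; unfold slope; destruct (Req_EM_T x (g y)) as [|Hne].
    - rewrite Rminus_diag_eq, Rabs_R0 by reflexivity; apply cond_pos.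
    - replace x with (g y + (x - g y)) at 1 by ring.
      apply Hd; [ lra | exact Hx ]. }
  assert (Hq : continuous (fun z => / slope (g z)) y).
  { apply continuous_Rinv_comp; [ | congruence ].
    apply (continuous_comp g slope); assumption. }
  apply is_derive_Reals; intros eps Heps.
  assert (Hqe := proj1 (filterlim_locally _ _) Hq (mkposreal eps Heps)).
  destruct (filter_and _ _ Hqe Hfg) as [d Hd].
  exists d; intros h Hh Hhd.
  destruct (Hd (y + h)) as [H1 H2].
  { change (Rabs (y + h - y) < d); replace (y + h - y) with h by ring; exact Hhd. }
  change (Rabs (/ slope (g (y + h)) - / slope (g y)) < eps) in H1.
  rewrite Hs0 in H1.
  assert (Hne : g (y + h) <> g y) by (intros E; rewrite E in H2; lra).
  assert (Hsl : / slope (g (y + h)) = (g (y + h) - g y) / h).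
  { unfold slope; destruct (Req_EM_T (g (y + h)) (g y)) as [|_]; [ easy | ].
    rewrite H2, Hy; field; split; [ lra | ].
    replace (y + h - y) with h by ring; lra. }
  rewrite <- Hsl; exact H1.
Qed.

(** * Invariants of the motion and the radius of a given density *)

(** The adiabatic exponent and the values of the four first integrals. *)
Record invariants := Invariants {
  gam : R;
  entropy : R;
  flux : R;
  swirl : R;
  energy : R
}.

Definition admissible (q : invariants) : Prop :=
  1 < gam q /\ 0 < entropy q /\ flux q <> 0 /\ 0 < energy q.

(** The specific enthalpy [c ^ 2 / (gamma - 1)]. *)
Definition enthalpy (q : invariants) (d : R) : R :=
  gam q * entropy q / (gam q - 1) * Rpower d (gam q - 1).

Definition density_of_enthalpy (q : invariants) (e : R) : R :=
  Rpower (e * (gam q - 1) / (gam q * entropy q)) (1 / (gam q - 1)).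

Definition bernoulli (q : invariants) (r d : R) : Prop :=
  / 2 * ((flux q / (r * d)) ^ 2 + (swirl q / r) ^ 2) + enthalpy q d = energy q.

(** The densities that leave a positive kinetic energy. *)
Definition physical (q : invariants) (d : R) : Prop :=
  0 < d /\ enthalpy q d < energy q.

(** Bernoulli's law solved for [r ^ 2]. *)
Definition radius_sq (q : invariants) (d : R) : R :=
  (flux q ^ 2 / d ^ 2 + swirl q ^ 2) / (2 * (energy q - enthalpy q d)).

(** Up to the factor [2 * d ^ 3 * (energy q - enthalpy q d) ^ 2] this is the
    derivative of [radius_sq].  At the radius where the density [d] occurs it
    equals [(flux q ^ 2 + swirl q ^ 2 * d ^ 2) * (c ^ 2 - U1 ^ 2)], so its sign is
    that of [1 - M_1 ^ 2]. *)
Definition sonic_gap (q : invariants) (d : R) : R :=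
  (flux q ^ 2 + swirl q ^ 2 * d ^ 2) * ((gam q - 1) * enthalpy q d)
  - 2 * flux q ^ 2 * (energy q - enthalpy q d).

Definition limiting_density (q : invariants) (ds : R) : Prop :=
  physical q ds /\ sonic_gap q ds = 0.

Lemma enthalpy_pos q d : admissible q -> 0 < enthalpy q d.
Proof.
  intros (Hg & Ha & _); unfold enthalpy; apply Rmult_lt_0_compat.
  - apply Rdiv_lt_0_compat; [ apply Rmult_lt_0_compat; lra | lra ].
  - apply exp_pos.
Qed.

Lemma enthalpy_increasing q d d' :
  admissible q -> 0 < d -> d < d' -> enthalpy q d < enthalpy q d'.
Proof.
  intros (Hg & Ha & _) Hd Hdd; unfold enthalpy; apply Rmult_lt_compat_l.
  - apply Rdiv_lt_0_compat; [ apply Rmult_lt_0_compat; lra | lra ].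
  - apply Rlt_Rpower_l; lra.
Qed.

Lemma enthalpy_lt_iff q d d' :
  admissible q -> 0 < d -> 0 < d' ->
  (enthalpy q d < enthalpy q d' <-> d < d').
Proof.
  intros Hq Hd Hd'; split; [ | now apply enthalpy_increasing ].
  intros H; destruct (Rlt_or_le d d') as [|[Hlt|Heq]]; [ easy | | ].
  - apply (enthalpy_increasing q) in Hlt; trivial; lra.
  - subst; lra.
Qed.

Lemma density_of_enthalpyK q e :
  admissible q -> 0 < e ->
  0 < density_of_enthalpy q e /\ enthalpy q (density_of_enthalpy q e) = e.
Proof.
  intros (Hg & Ha & _) He; split; [ apply exp_pos | ].
  unfold enthalpy, density_of_enthalpy; rewrite Rpower_mult.
  replace (1 / (gam q - 1) * (gam q - 1)) with 1 by (field; lra).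
  rewrite Rpower_1; [ field; lra | ].
  apply Rdiv_lt_0_compat; apply Rmult_lt_0_compat; lra.
Qed.

Lemma is_derive_enthalpy q d :
  admissible q -> 0 < d ->
  is_derive (enthalpy q) d ((gam q - 1) * enthalpy q d / d).
Proof.
  intros (Hg & Ha & _) Hd.
  replace ((gam q - 1) * enthalpy q d / d) with
    (gam q * entropy q / (gam q - 1) * ((gam q - 1) * Rpower d (gam q - 1 - 1))).
  - apply (is_derive_scal (fun x => Rpower x (gam q - 1))).
    apply is_derive_Reals, derivable_pt_lim_power, Hd.
  - unfold enthalpy; rewrite (Rpower_plus (gam q - 1) (-(1))).
    rewrite Rpower_Ropp, Rpower_1 by assumption; field; lra.
Qed.

Lemma continuous_enthalpy q d :
  admissible q -> 0 < d -> continuous (enthalpy q) d.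
Proof.
  intros Hq Hd; apply (ex_derive_continuous (enthalpy q)).
  eexists; now apply is_derive_enthalpy.
Qed.

Lemma is_derive_radius_sq q d :
  admissible q -> physical q d ->
  is_derive (radius_sq q) d
    (sonic_gap q d / (2 * d ^ 3 * (energy q - enthalpy q d) ^ 2)).
Proof.
  intros Hq [Hd He]; assert (Hh := is_derive_enthalpy q d Hq Hd).
  unfold radius_sq; auto_derive.
  - split; [ apply (pow_nonzero d 2); lra | ].
    split; [ eexists; exact Hh | ].
    split; [ lra | easy ].
  - replace (Derive (fun x => enthalpy q x) d) with ((gam q - 1) * enthalpy q d / d)
      by (symmetry; apply is_derive_unique, Hh).
    unfold sonic_gap; field; split; lra.
Qed.

Lemma sonic_gap_increasing q d d' :
  admissible q -> 0 < d -> d < d' -> sonic_gap q d < sonic_gap q d'.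
Proof.
  intros Hq Hd Hdd.
  assert (Hi := enthalpy_increasing q d d' Hq Hd Hdd).
  assert (Hp := enthalpy_pos q d Hq).
  destruct Hq as (Hg & _ & Hk & _).
  assert (Hf : 0 < flux q ^ 2) by (apply pow2_gt_0, Hk).
  assert (Hs : 0 <= swirl q ^ 2) by apply pow2_ge_0.
  assert (Hd2 : d ^ 2 <= d' ^ 2) by (apply pow_incr; lra).
  assert (Hd0 : 0 < d ^ 2) by (apply pow_lt; lra).
  assert (H1 : flux q ^ 2 + swirl q ^ 2 * d ^ 2
               <= flux q ^ 2 + swirl q ^ 2 * d' ^ 2)
    by (apply Rplus_le_compat_l, Rmult_le_compat_l; lra).
  assert (H0 : 0 < flux q ^ 2 + swirl q ^ 2 * d ^ 2) by nra.
  assert (H2 : (gam q - 1) * enthalpy q d < (gam q - 1) * enthalpy q d')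
    by (apply Rmult_lt_compat_l; lra).
  assert (H3 : 0 < (gam q - 1) * enthalpy q d) by (apply Rmult_lt_0_compat; lra).
  assert (H4 : flux q ^ 2 * enthalpy q d < flux q ^ 2 * enthalpy q d')
    by (apply Rmult_lt_compat_l; lra).
  assert (H5 : (flux q ^ 2 + swirl q ^ 2 * d ^ 2) * ((gam q - 1) * enthalpy q d)
    < (flux q ^ 2 + swirl q ^ 2 * d' ^ 2) * ((gam q - 1) * enthalpy q d')).
  { apply Rle_lt_trans with
      ((flux q ^ 2 + swirl q ^ 2 * d' ^ 2) * ((gam q - 1) * enthalpy q d)).
    - apply Rmult_le_compat_r; lra.
    - apply Rmult_lt_compat_l; lra. }
  unfold sonic_gap; lra.
Qed.

Lemma continuous_sonic_gap q d :
  admissible q -> 0 < d -> continuous (sonic_gap q) d.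
Proof.
  intros Hq Hd; apply (ex_derive_continuous (sonic_gap q)).
  unfold sonic_gap; auto_derive; repeat split;
    eexists; now apply is_derive_enthalpy.
Qed.

Lemma sonic_gap_neq0 q ds d :
  admissible q -> limiting_density q ds -> 0 < d -> d <> ds -> sonic_gap q d <> 0.
Proof.
  intros Hq [[Hs _] Hz] Hd Hne; destruct (Rtotal_order d ds) as [H|[H|H]]; [ | easy | ];
    apply (sonic_gap_increasing q) in H; trivial; lra.
Qed.

(** By the intermediate value theorem: the sonic gap is positive when the enthalpy
    takes up all the energy, and tends to [- 2 * flux q ^ 2 * energy q] as the
    density tends to [0]. *)
Lemma limiting_density_exists q :
  admissible q -> exists ds, limiting_density q ds.
Proof.
  intros Hq; assert (Hq' := Hq); destruct Hq' as (Hg & Ha & Hk & Hb).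
  assert (Hf : 0 < flux q ^ 2) by (apply pow2_gt_0, Hk).
  assert (Hs : 0 <= swirl q ^ 2) by apply pow2_ge_0.
  set (m := (flux q ^ 2 + swirl q ^ 2) * (gam q - 1) + 2 * flux q ^ 2).
  assert (Hm : 2 * flux q ^ 2 < m).
  { unfold m; assert (0 < (flux q ^ 2 + swirl q ^ 2) * (gam q - 1))
      by (apply Rmult_lt_0_compat; lra); lra. }
  (* With [d <= 1] the sonic gap at enthalpy [e] is at most
     [e * m - 2 * flux q ^ 2 * energy q]. *)
  set (e := Rmin (enthalpy q 1) (flux q ^ 2 * energy q / m)).
  assert (He : 0 < e).
  { apply Rmin_pos; [ now apply enthalpy_pos | ].
    apply Rdiv_lt_0_compat; [ apply Rmult_lt_0_compat; lra | lra ]. }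
  assert (Hem : e * m <= flux q ^ 2 * energy q).
  { apply Rle_trans with (flux q ^ 2 * energy q / m * m).
    - apply Rmult_le_compat_r; [ lra | apply Rmin_r ].
    - right; field; lra. }
  destruct (density_of_enthalpyK q e Hq He) as [Hd Hde].
  destruct (density_of_enthalpyK q (energy q) Hq Hb) as [HM HMe].
  set (d := density_of_enthalpy q e) in *.
  set (dM := density_of_enthalpy q (energy q)) in *.
  assert (Hd1 : d <= 1).
  { apply Rnot_lt_le; intros H.
    apply (enthalpy_increasing q) in H; [ | easy | lra ].
    assert (e <= enthalpy q 1) by apply Rmin_l; lra. }
  assert (Hlow : sonic_gap q d < 0).
  { unfold sonic_gap; rewrite Hde.
    assert (d ^ 2 <= 1) by (rewrite <- (pow1 2); apply pow_incr; lra).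
    assert (swirl q ^ 2 * d ^ 2 <= swirl q ^ 2 * 1) by (apply Rmult_le_compat_l; lra).
    assert (0 < (gam q - 1) * e) by (apply Rmult_lt_0_compat; lra).
    assert ((flux q ^ 2 + swirl q ^ 2 * d ^ 2) * ((gam q - 1) * e)
            <= (flux q ^ 2 + swirl q ^ 2) * ((gam q - 1) * e))
      by (apply Rmult_le_compat_r; lra).
    assert (0 < flux q ^ 2 * energy q) by (apply Rmult_lt_0_compat; lra).
    unfold m in Hem; nra. }
  assert (Hhigh : 0 < sonic_gap q dM).
  { unfold sonic_gap; rewrite HMe.
    assert (0 <= swirl q ^ 2 * dM ^ 2)
      by (apply Rmult_le_pos; [ lra | apply pow2_ge_0 ]).
    assert (0 < (gam q - 1) * energy q) by (apply Rmult_lt_0_compat; lra).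
    assert (0 < (flux q ^ 2 + swirl q ^ 2 * dM ^ 2) * ((gam q - 1) * energy q))
      by (apply Rmult_lt_0_compat; lra).
    lra. }
  assert (HddM : d < dM).
  { destruct (Rlt_or_le d dM) as [|[H|H]]; [ easy | | rewrite H in *; lra ].
    apply (sonic_gap_increasing q) in H; trivial; lra. }
  destruct (IVT_interv (sonic_gap q) d dM) as [ds [Hds Hz]]; trivial.
  { intros x Hx; apply continuity_pt_filterlim, continuous_sonic_gap; trivial; lra. }
  exists ds; split; [ | exact Hz ].
  assert (ds <> dM) by (intros E; rewrite E in Hz; lra).
  split; [ lra | ].
  rewrite <- HMe; apply enthalpy_increasing; trivial; lra.
Qed.

Lemma physical_between q d d' x :
  admissible q -> physical q d -> physical q d' ->
  Rmin d d' <= x <= Rmax d d' -> physical q x.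
Proof.
  intros Hq [Hd He] [Hd' He'] [H1 H2].
  assert (Hx : 0 < x) by (apply Rlt_le_trans with (2 := H1), Rmin_pos; easy).
  split; [ exact Hx | ].
  assert (Hle : forall y, 0 < y -> enthalpy q y < energy q -> x <= y ->
            enthalpy q x < energy q).
  { intros y Hy Hye [Hl|Hl]; [ | now subst ].
    apply (enthalpy_increasing q) in Hl; trivial; lra. }
  destruct (Rle_or_lt x d) as [|Hxd]; [ now apply (Hle d) | ].
  apply (Hle d'); trivial.
  unfold Rmax in H2; destruct (Rle_dec d d'); lra.
Qed.

Lemma radius_sq_mean_value q d d' :
  admissible q -> physical q d -> physical q d' -> d < d' ->
  exists c l, d < c < d' /\ 0 < l /\
    radius_sq q d' - radius_sq q d = l * sonic_gap q c.
Proof.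
  intros Hq Hd Hd' Hlt.
  assert (Hp : forall c, d <= c <= d' -> physical q c).
  { intros c Hc; apply (physical_between q d d'); trivial.
    rewrite Rmin_left, Rmax_right; lra. }
  destruct (MVT_cor2 (radius_sq q)
    (fun d => sonic_gap q d / (2 * d ^ 3 * (energy q - enthalpy q d) ^ 2)) d d')
    as [c [Hc Hcb]]; [ easy | | ].
  { intros c Hc; apply is_derive_Reals, is_derive_radius_sq; auto. }
  destruct (Hp c) as [Hc0 Hce]; [ lra | ].
  assert (0 < 2 * c ^ 3 * (energy q - enthalpy q c) ^ 2).
  { repeat apply Rmult_lt_0_compat; lra. }
  exists c, ((d' - d) / (2 * c ^ 3 * (energy q - enthalpy q c) ^ 2)).
  split; [ easy | split ].
  - apply Rdiv_lt_0_compat; lra.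
  - rewrite Hc; field; repeat split; lra.
Qed.

(** The derivative of [radius_sq] vanishes at [ds]; the mean value theorem places
    the intermediate point strictly away from it, where the sonic gap has a
    strict sign. *)
Lemma radius_sq_increases_away q ds d d' :
  admissible q -> limiting_density q ds -> physical q d -> physical q d' ->
  ds <= d < d' \/ d' < d <= ds -> radius_sq q d < radius_sq q d'.
Proof.
  intros Hq [[Hs0 _] Hs] Hd Hd' [Hlt|Hlt].
  - destruct (radius_sq_mean_value q d d') as (c & l & Hc & Hl & He);
      trivial; try lra.
    assert (0 < sonic_gap q c)
      by (rewrite <- Hs; apply sonic_gap_increasing; trivial; lra).
    assert (0 < l * sonic_gap q c) by (apply Rmult_lt_0_compat; lra); lra.
  - destruct (radius_sq_mean_value q d' d) as (c & l & Hc & Hl & He);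
      trivial; try lra.
    assert (sonic_gap q c < 0)
      by (rewrite <- Hs; destruct Hd'; apply sonic_gap_increasing; trivial; lra).
    assert (0 < l * - sonic_gap q c) by (apply Rmult_lt_0_compat; lra); lra.
Qed.

Lemma radius_sq_min q ds d :
  admissible q -> limiting_density q ds -> physical q d -> d <> ds ->
  radius_sq q ds < radius_sq q d.
Proof.
  intros Hq Hl Hd Hne; apply (radius_sq_increases_away q ds); trivial.
  - apply Hl.
  - lra.
Qed.

Lemma radius_sq_injective q ds d d' :
  admissible q -> limiting_density q ds -> physical q d -> physical q d' ->
  (ds <= d /\ ds <= d' \/ d <= ds /\ d' <= ds) ->
  radius_sq q d = radius_sq q d' -> d = d'.
Proof.
  intros Hq Hl Hd Hd' Hb He.
  destruct (Rtotal_order d d') as [H|[H|H]]; [ | easy | ].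
  - destruct Hb as [Hb|Hb].
    + assert (radius_sq q d < radius_sq q d')
        by (apply (radius_sq_increases_away q ds); trivial; lra); lra.
    + assert (radius_sq q d' < radius_sq q d)
        by (apply (radius_sq_increases_away q ds); trivial; lra); lra.
  - destruct Hb as [Hb|Hb].
    + assert (radius_sq q d' < radius_sq q d)
        by (apply (radius_sq_increases_away q ds); trivial; lra); lra.
    + assert (radius_sq q d < radius_sq q d')
        by (apply (radius_sq_increases_away q ds); trivial; lra); lra.
Qed.

Lemma radius_sq_lt_iff q ds d d' :
  admissible q -> limiting_density q ds -> physical q d -> physical q d' ->
  ds <= d -> ds <= d' -> (radius_sq q d < radius_sq q d' <-> d < d').
Proof.
  intros Hq Hl Hd Hd' H H'; split; intros Hlt.
  - destruct (Rlt_or_le d d') as [|[Hgt|Heq]]; [ easy | | subst; lra ].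
    assert (radius_sq q d' < radius_sq q d)
      by (apply (radius_sq_increases_away q ds); trivial; lra); lra.
  - apply (radius_sq_increases_away q ds); trivial; lra.
Qed.

Lemma radius_sq_pos q d : admissible q -> physical q d -> 0 < radius_sq q d.
Proof.
  intros (_ & _ & Hk & _) [Hd He]; apply Rdiv_lt_0_compat; [ | lra ].
  assert (0 < flux q ^ 2 / d ^ 2)
    by (apply Rdiv_lt_0_compat; [ apply pow2_gt_0, Hk | apply pow_lt, Hd ]).
  assert (0 <= swirl q ^ 2) by apply pow2_ge_0; lra.
Qed.

Lemma bernoulli_iff q r d :
  0 < r -> 0 < d -> flux q <> 0 ->
  (bernoulli q r d <-> physical q d /\ radius_sq q d = r ^ 2).
Proof.
  intros Hr Hd Hk.
  assert (Hn : 0 < flux q ^ 2 / d ^ 2 + swirl q ^ 2).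
  { assert (0 < flux q ^ 2 / d ^ 2)
      by (apply Rdiv_lt_0_compat; [ apply pow2_gt_0, Hk | apply pow_lt, Hd ]).
    assert (0 <= swirl q ^ 2) by apply pow2_ge_0; lra. }
  assert (Hkin : / 2 * ((flux q / (r * d)) ^ 2 + (swirl q / r) ^ 2)
                 = (flux q ^ 2 / d ^ 2 + swirl q ^ 2) / (2 * r ^ 2))
    by (field; lra).
  assert (Hr2 : 0 < r ^ 2) by (apply pow_lt, Hr).
  unfold bernoulli; rewrite Hkin; split.
  - intros H.
    assert (0 < (flux q ^ 2 / d ^ 2 + swirl q ^ 2) / (2 * r ^ 2))
      by (apply Rdiv_lt_0_compat; lra).
    split; [ split; lra | ].
    unfold radius_sq.
    remember (flux q ^ 2 / d ^ 2 + swirl q ^ 2) as n eqn:En.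
    replace (energy q - enthalpy q d) with (n / (2 * r ^ 2)) by lra.
    field; lra.
  - intros [[_ He] H].
    assert (E : (flux q ^ 2 / d ^ 2 + swirl q ^ 2)
                = r ^ 2 * (2 * (energy q - enthalpy q d)))
      by (rewrite <- H; unfold radius_sq; field; lra).
    rewrite E; field; lra.
Qed.

(** * Inverting one branch of the radius function *)

(** The segment from [ds] to [d0] is parametrised by [t] in [[0, 1]].  Along it
    [radius_sq] increases whichever side of [ds] contains [d0], so the branches
    with [M_1 > 1] and [M_1 < 1] are inverted by the same argument. *)
Lemma density_branch q ds d0 :
  admissible q -> limiting_density q ds -> physical q d0 -> d0 <> ds ->
  exists dens : R -> R, (forall y, continuous dens y) /\
    forall y, radius_sq q ds <= y <= radius_sq q d0 ->
      Rmin ds d0 <= dens y <= Rmax ds d0 /\ radius_sq q (dens y) = y.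
Proof.
  intros Hq Hl Hd0 Hne.
  pose (seg := fun t => ds + t * (d0 - ds)).
  assert (Hb : forall t, 0 <= t <= 1 -> Rmin ds d0 <= seg t <= Rmax ds d0).
  { intros t Ht; unfold seg, Rmin, Rmax; destruct (Rle_dec ds d0); nra. }
  assert (Hp : forall t, 0 <= t <= 1 -> physical q (seg t)).
  { intros t Ht; apply (physical_between q ds d0); auto; apply Hl. }
  destruct (continuous_increasing_inverse 0 1 (fun t => radius_sq q (seg t)))
    as [g [Hg1 Hg2]].
  - lra.
  - intros t Ht; apply (continuous_comp seg (radius_sq q)).
    + apply (ex_derive_continuous seg); unfold seg; auto_derive; easy.
    + apply (ex_derive_continuous (radius_sq q)); eexists; apply is_derive_radius_sq; auto.
  - intros s t Hs Hst Ht; apply (radius_sq_increases_away q ds); trivial;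
      try (apply Hp; lra).
    unfold seg; destruct (Rtotal_order d0 ds) as [H|[H|H]]; [ right | easy | left ];
      split; nra.
  - exists (fun y => seg (g y)); split.
    + intros y; apply (continuous_comp g seg); [ apply Hg1 | ].
      apply (ex_derive_continuous seg); unfold seg; auto_derive; easy.
    + intros y Hy; destruct (Hg2 y) as [H1 H2]; split; [ now apply Hb | ].
      rewrite H2; apply clamp_id; unfold seg.
      replace (ds + 0 * (d0 - ds)) with ds by ring.
      replace (ds + 1 * (d0 - ds)) with d0 by ring; exact Hy.
Qed.

(** The chain rule value of [rho'] for [radius_sq q rho = r ^ 2]. *)
Definition density_slope (q : invariants) (d r : R) : R :=
  2 * r * (/ (sonic_gap q d / (2 * d ^ 3 * (energy q - enthalpy q d) ^ 2))).

Lemma is_derive_density_branch q (dens : R -> R) r :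
  admissible q -> continuous dens (r ^ 2) ->
  locally (r ^ 2) (fun y => radius_sq q (dens y) = y) ->
  physical q (dens (r ^ 2)) -> sonic_gap q (dens (r ^ 2)) <> 0 ->
  is_derive (fun s => dens (s ^ 2)) r (density_slope q (dens (r ^ 2)) r).
Proof.
  intros Hq Hc Hinv Hp Hs.
  apply (is_derive_comp dens (fun s => s ^ 2)).
  - apply (is_derive_continuous_inverse (radius_sq q)); trivial.
    + destruct Hp; apply Rmult_integral_contrapositive_currified; [ easy | ].
      apply Rinv_neq_0_compat, Rgt_not_eq; repeat apply Rmult_lt_0_compat; lra.
    + now apply is_derive_radius_sq.
  - auto_derive; [ easy | ring ].
Qed.

Lemma continuous_density_slope q (dens : R -> R) r :
  admissible q -> continuous dens r ->
  physical q (dens r) -> sonic_gap q (dens r) <> 0 ->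
  continuous (fun s => density_slope q (dens s) s) r.
Proof.
  intros Hq Hc [Hp He] Hs; unfold density_slope.
  assert (Hden : 0 < 2 * dens r ^ 3 * (energy q - enthalpy q (dens r)) ^ 2)
    by (repeat apply Rmult_lt_0_compat; lra).
  apply (continuous_mult (fun s => 2 * s)).
  { apply (ex_derive_continuous (fun s => 2 * s)); auto_derive; easy. }
  apply continuous_Rinv_comp.
  2: { apply Rmult_integral_contrapositive_currified; [ easy | ].
       apply Rinv_neq_0_compat; lra. }
  apply (continuous_comp dens
    (fun d => sonic_gap q d / (2 * d ^ 3 * (energy q - enthalpy q d) ^ 2)));
    [ easy | ].
  apply (ex_derive_continuous (fun d =>
    sonic_gap q d / (2 * d ^ 3 * (energy q - enthalpy q d) ^ 2))).
  unfold sonic_gap; auto_derive.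
  repeat split; try (eexists; now apply is_derive_enthalpy); lra.
Qed.

(** * The Euler system and its first integrals *)

(** The flow at [r] is the one that the invariants prescribe for its density. *)
Definition reduced_at (q : invariants) (w : flow) (r : R) : Prop :=
  U1 w r = flux q / (r * rho w r) /\ U2 w r = swirl q / r /\
  A w r = entropy q /\ bernoulli q r (rho w r).

Definition inflow_invariants (gamma r1 rho0 A0 U10 U20 : R) : invariants :=
  Invariants gamma A0 (kappa1 r1 rho0 U10) (kappa2 r1 U20)
    (B0 gamma rho0 A0 U10 U20).

Lemma inflow_admissible gamma r1 rho0 A0 U10 U20 :
  gamma > 1 -> r1 > 0 -> rho0 > 0 -> A0 > 0 -> U10 < 0 ->
  admissible (inflow_invariants gamma r1 rho0 A0 U10 U20).
Proof.
  intros Hg Hr1 Hrho HA HU.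
  assert (0 < r1 * rho0 * - U10) by (repeat apply Rmult_lt_0_compat; lra).
  assert (0 < U10 ^ 2) by (apply pow2_gt_0; lra).
  assert (0 <= U20 ^ 2) by apply pow2_ge_0.
  assert (0 < gamma * A0 / (gamma - 1) * Rpower rho0 (gamma - 1)).
  { apply Rmult_lt_0_compat; [ | apply exp_pos ].
    apply Rdiv_lt_0_compat; [ apply Rmult_lt_0_compat; lra | lra ]. }
  unfold admissible; simpl; repeat split; try lra.
  - unfold kappa1; lra.
  - unfold B0; lra.
Qed.

Lemma is_derive_square (f : R -> R) x l :
  is_derive f x l -> is_derive (fun y => f y * f y) x (2 * f x * l).
Proof.
  intros H; replace (2 * f x * l) with (l * f x + f x * l) by ring.
  apply (is_derive_mult f f); [ exact H | exact H | exact Rmult_comm ].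
Qed.

Lemma is_derive_pressure gamma w r dr da :
  0 < rho w r -> is_derive (rho w) r dr -> is_derive (A w) r da ->
  is_derive (pressure gamma w) r
    (da * Rpower (rho w r) gamma
     + A w r * (dr * (gamma * Rpower (rho w r) (gamma - 1)))).
Proof.
  intros Hp Hr Ha.
  apply (is_derive_mult (A w) (fun s => Rpower (rho w s) gamma) r da
    (dr * (gamma * Rpower (rho w r) (gamma - 1)))); [ easy | | exact Rmult_comm ].
  apply (is_derive_comp (fun d => Rpower d gamma) (rho w)); [ | easy ].
  apply is_derive_Reals, derivable_pt_lim_power, Hp.
Qed.

(** The mass flux is conserved first, which gives [U1 <> 0]; only then can [U1] be
    cancelled from the swirl and entropy equations.  With these two, the momentum
    equation says that the Bernoulli energy has zero derivative. *)
Lemma first_integrals gamma r1 rho0 A0 U10 U20 r0 w :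
  gamma > 1 -> A0 > 0 -> rho0 > 0 -> U10 < 0 -> 0 < r0 < r1 ->
  smooth_solution gamma r1 rho0 A0 U10 U20 r0 w ->
  forall r, r0 <= r <= r1 ->
    reduced_at (inflow_invariants gamma r1 rho0 A0 U10 U20) w r.
Proof.
  intros Hg HA Hrho HU Hr0 Hsol.
  destruct Hsol as [[S1 [S2 [S3 S4]]] [Hpos [Heul [B3 [B1 [B2 B4]]]]]].
  destruct S1 as [D1 C1], S2 as [D2 C2], S3 as [D3 C3], S4 as [D4 C4].
  assert (K : forall r, r0 < r < r1 ->
    is_derive (U1 w) r (Derive (U1 w) r) /\ is_derive (U2 w) r (Derive (U2 w) r) /\
    is_derive (rho w) r (Derive (rho w) r) /\ is_derive (A w) r (Derive (A w) r)).
  { intros r Hr; split; [ | split; [ | split ] ]; apply Derive_correct;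
      [ apply D1 | apply D2 | apply D3 | apply D4 ]; exact Hr. }
  assert (Cid : continuous_on (fun r => r0 <= r <= r1) (fun r : R => r))
    by (apply continuous_on_forall; intros; apply continuous_id).
  assert (Hk : kappa1 r1 rho0 U10 < 0).
  { unfold kappa1.
    assert (0 < r1 * rho0 * - U10)
      by (repeat apply Rmult_lt_0_compat; lra); lra. }
  assert (Hflux : forall r, r0 <= r <= r1 ->
            r * (rho w r * U1 w r) = kappa1 r1 rho0 U10).
  { intros r Hr.
    rewrite (constant_on_closed r0 r1 (fun s => s * (rho w s * U1 w s))); trivial.
    - rewrite B1, B3; unfold kappa1; ring.
    - lra.
    - apply (continuous_on_mult _ (fun s => s)); [ easy | ].
      now apply (continuous_on_mult _ (rho w)).
    - intros s Hs; destruct (K s Hs) as (K1 & _ & K3 & _).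
      assert (K13 : is_derive (fun x => rho w x * U1 w x) s
                (Derive (fun x => rho w x * U1 w x) s)).
      { apply Derive_correct, (ex_derive_mult (rho w) (U1 w)); eexists; eassumption. }
      destruct (Heul s Hs) as [E1 _].
      replace 0 with (1 * (rho w s * U1 w s)
        + s * Derive (fun x => rho w x * U1 w x) s).
      + apply (is_derive_mult (fun x : R => x) (fun x => rho w x * U1 w x));
          [ exact (@is_derive_id R_AbsRing s) | easy | exact Rmult_comm ].
      + replace (Derive (fun x => rho w x * U1 w x) s)
          with (- (/ s * (rho w s * U1 w s))) by lra.
        field; lra. }
  assert (HU1 : forall r, r0 <= r <= r1 -> U1 w r <> 0).
  { intros r Hr E; specialize (Hflux r Hr); rewrite E in Hflux; lra. }
  assert (Hswirl' : forall r, r0 < r < r1 -> Derive (U2 w) r = - (U2 w r / r)).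
  { intros r Hr; destruct (Heul r Hr) as (_ & _ & E3 & _).
    apply (Rmult_eq_reg_l (U1 w r)); [ | apply HU1; lra ].
    unfold Rdiv in *; lra. }
  assert (Hent' : forall r, r0 < r < r1 -> Derive (A w) r = 0).
  { intros r Hr; destruct (Heul r Hr) as (_ & _ & _ & E4).
    apply (Rmult_eq_reg_l (U1 w r)); [ lra | apply HU1; lra ]. }
  assert (Hswirl : forall r, r0 <= r <= r1 -> r * U2 w r = kappa2 r1 U20).
  { intros r Hr.
    rewrite (constant_on_closed r0 r1 (fun s => s * U2 w s)); trivial.
    - rewrite B2; reflexivity.
    - lra.
    - now apply (continuous_on_mult _ (fun s => s)).
    - intros s Hs; destruct (K s Hs) as (_ & K2 & _).
      replace 0 with (1 * U2 w s + s * Derive (U2 w) s)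
        by (rewrite (Hswirl' s Hs); field; lra).
      apply (is_derive_mult (fun x : R => x) (U2 w));
        [ exact (@is_derive_id R_AbsRing s) | easy | exact Rmult_comm ]. }
  assert (Hent : forall r, r0 <= r <= r1 -> A w r = A0).
  { intros r Hr; rewrite <- B4.
    apply (constant_on_closed r0 r1 (A w)); trivial; [ lra | ].
    intros s Hs; rewrite <- (Hent' s Hs); apply K, Hs. }
  set (q := inflow_invariants gamma r1 rho0 A0 U10 U20).
  assert (Hq : admissible q) by (apply inflow_admissible; lra).
  assert (Hbern : forall r, r0 <= r <= r1 ->
    / 2 * (U1 w r * U1 w r + U2 w r * U2 w r) + enthalpy q (rho w r) = energy q).
  { intros r Hr.
    rewrite (constant_on_closed r0 r1 (fun r =>
      / 2 * (U1 w r * U1 w r + U2 w r * U2 w r) + enthalpy q (rho w r))); trivial.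
    - rewrite B1, B2, B3; simpl; unfold B0, enthalpy; simpl; ring.
    - lra.
    - apply (continuous_on_plus _
        (fun r => / 2 * (U1 w r * U1 w r + U2 w r * U2 w r))
        (fun r => enthalpy q (rho w r))).
      + apply (continuous_on_mult _ (fun _ => / 2)).
        * apply continuous_on_forall; intros; apply continuous_const.
        * apply (continuous_on_plus _ (fun r => U1 w r * U1 w r));
            [ now apply (continuous_on_mult _ (U1 w))
            | now apply (continuous_on_mult _ (U2 w)) ].
      + apply continuous_on_comp; [ easy | ].
        intros s Hs; apply continuous_enthalpy; [ easy | now apply Hpos ].
    - intros s Hs; destruct (K s Hs) as (K1 & K2 & K3 & K4).
      assert (Hrs : 0 < rho w s) by (apply Hpos; lra).
      destruct (Heul s Hs) as (_ & E2 & _ & _).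
      rewrite (is_derive_unique _ _ _ (is_derive_pressure gamma w s _ _ Hrs K3 K4)) in E2.
      rewrite (Hent' s Hs), Hent in E2 by lra.
      replace 0 with
        (/ 2 * (2 * U1 w s * Derive (U1 w) s + 2 * U2 w s * Derive (U2 w) s)
         + Derive (rho w) s * ((gam q - 1) * enthalpy q (rho w s) / rho w s)).
      + apply (is_derive_plus
          (fun r => / 2 * (U1 w r * U1 w r + U2 w r * U2 w r))
          (fun r => enthalpy q (rho w r))).
        * apply (is_derive_scal (fun r => U1 w r * U1 w r + U2 w r * U2 w r)).
          apply (is_derive_plus (fun r => U1 w r * U1 w r) (fun r => U2 w r * U2 w r));
            now apply is_derive_square.
        * apply (is_derive_comp (enthalpy q) (rho w)); [ | easy ].
          now apply is_derive_enthalpy.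
      + rewrite (Hswirl' s Hs); rewrite <- E2; unfold enthalpy; simpl.
        field; repeat split; lra. }
  intros r Hr.
  assert (Hrs : 0 < rho w r) by (apply Hpos; lra).
  assert (E1 : U1 w r = flux q / (r * rho w r))
    by (simpl; rewrite <- (Hflux r Hr); field; lra).
  assert (E2 : U2 w r = swirl q / r)
    by (simpl; rewrite <- (Hswirl r Hr); field; lra).
  repeat split; trivial.
  - now apply Hent.
  - unfold bernoulli; rewrite <- (Hbern r Hr), <- E1, <- E2; ring.
Qed.

Definition reduced_flow (q : invariants) (dens : R -> R) : flow :=
  Flow (fun r => flux q / (r * dens r)) (fun r => swirl q / r) dens
    (fun _ => entropy q).

Lemma smooth_on_of_derivative a b (f df : R -> R) :
  (forall x, a < x < b -> is_derive f x (df x)) ->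
  (forall x, a < x < b -> continuous df x) ->
  (forall x, a <= x <= b -> continuous f x) -> smooth_on a b f.
Proof.
  intros Hd Hc Hf; split; [ | now apply continuous_on_forall ].
  intros x Hx; split; [ eexists; now apply Hd | ].
  apply (continuous_ext_loc _ df); [ | now apply Hc ].
  apply (locally_interval _ x a b); simpl; try lra.
  intros y Hy1 Hy2; symmetry; apply is_derive_unique, Hd; simpl in *; lra.
Qed.

(** The converse of [first_integrals]: the momentum equation is the derivative of
    Bernoulli's law, hence holds for every [C^1] density that satisfies this
    law on the annulus. *)
Lemma reduced_flow_solves q r0 r1 (dens ddens : R -> R) :
  admissible q -> 0 < r0 ->
  (forall r, r0 <= r <= r1 ->
     continuous dens r /\ 0 < dens r /\ bernoulli q r (dens r)) ->
  (forall r, r0 < r < r1 -> is_derive dens r (ddens r) /\ continuous ddens r) ->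
  smooth_flow r0 r1 (reduced_flow q dens) /\
  forall r, r0 < r < r1 -> steady_euler_at (gam q) (reduced_flow q dens) r.
Proof.
  intros Hq Hr0 Hdens Hder.
  assert (D1 : forall r, r0 < r < r1 -> is_derive (fun s => flux q / (s * dens s)) r
    (- flux q * (dens r + r * ddens r) * / ((r * dens r) * (r * dens r)))).
  { intros r Hr; destruct (Hdens r) as (_ & Hp & _); [ lra | ].
    destruct (Hder r Hr) as [Hd _].
    assert (r * dens r <> 0) by (apply Rmult_integral_contrapositive_currified; lra).
    auto_derive; [ split; [ eexists; exact Hd | easy ] | ].
    replace (Derive (fun s => dens s) r) with (ddens r)
      by (symmetry; now apply is_derive_unique).
    field; split; lra. }
  assert (D2 : forall r, r0 < r < r1 ->
            is_derive (fun s => swirl q / s) r (- swirl q / (r * r))).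
  { intros r Hr; auto_derive; [ lra | field; lra ]. }
  split.
  - unfold smooth_flow; simpl; repeat match goal with |- _ /\ _ => split end.
    + eapply smooth_on_of_derivative; [ exact D1 | | ].
      * intros r Hr; destruct (Hdens r) as (Hc & Hp & _); [ lra | ].
        destruct (Hder r Hr) as [_ Hdc].
        assert (Hrd : continuous (fun s => s * dens s) r)
          by (apply (continuous_mult (fun s => s) dens);
              [ apply continuous_id | exact Hc ]).
        apply (continuous_mult (fun s => - flux q * (dens s + s * ddens s))
                 (fun s => / ((s * dens s) * (s * dens s)))).
        -- apply (continuous_mult (fun _ => - flux q)); [ apply continuous_const | ].
           apply (continuous_plus dens (fun s => s * ddens s)); [ exact Hc | ].
           apply (continuous_mult (fun s => s) ddens);
             [ apply continuous_id | exact Hdc ].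
        -- apply continuous_Rinv_comp.
           ++ apply (continuous_mult (fun s => s * dens s) (fun s => s * dens s));
                exact Hrd.
           ++ repeat apply Rmult_integral_contrapositive_currified; lra.
      * intros r Hr; destruct (Hdens r Hr) as (Hc & Hp & _).
        apply (continuous_mult (fun _ => flux q)); [ apply continuous_const | ].
        apply continuous_Rinv_comp.
        -- apply (continuous_mult (fun s => s) dens);
             [ apply continuous_id | exact Hc ].
        -- apply Rmult_integral_contrapositive_currified; lra.
    + eapply smooth_on_of_derivative; [ exact D2 | | ];
        intros r Hr.
      * apply (ex_derive_continuous (fun s => - swirl q / (s * s))).
        auto_derive; apply Rmult_integral_contrapositive_currified; lra.
      * apply (ex_derive_continuous (fun s => swirl q / s)); auto_derive; lra.
    + apply (smooth_on_of_derivative r0 r1 dens ddens); [ apply Hder | apply Hder | ].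
      apply Hdens.
    + apply (smooth_on_of_derivative r0 r1 _ (fun _ => 0)); intros.
      * apply (is_derive_const (entropy q)).
      * apply continuous_const.
      * apply continuous_const.
  - intros r Hr; destruct (Hdens r) as (Hc & Hp & _); [ lra | ].
    destruct (Hder r Hr) as [Hd _]; specialize (D1 r Hr); specialize (D2 r Hr).
    assert (Hloc : forall P : R -> Prop,
      (forall s, r0 < s < r1 -> P s) -> locally r P).
    { intros P HP; apply (locally_interval _ r r0 r1); simpl; try lra.
      intros; apply HP; simpl in *; lra. }
    unfold steady_euler_at; simpl.
    assert (E1 : Derive (fun s : R => flux q / (s * dens s)) r =
      - flux q * (dens r + r * ddens r) * / ((r * dens r) * (r * dens r)))
      by exact (is_derive_unique _ _ _ D1).
    assert (E2 : Derive (fun s : R => swirl q / s) r = - swirl q / (r * r))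
      by exact (is_derive_unique _ _ _ D2).
    assert (Hpr : is_derive (pressure (gam q) (reduced_flow q dens)) r
      (0 * Rpower (dens r) (gam q)
       + entropy q * (ddens r * (gam q * Rpower (dens r) (gam q - 1))))).
    { apply (is_derive_pressure (gam q) (reduced_flow q dens) r (ddens r) 0); trivial.
      apply (is_derive_const (entropy q)). }
    rewrite (is_derive_unique _ _ _ Hpr), E1, E2.
    repeat match goal with |- _ /\ _ => split end.
    + rewrite (Derive_ext_loc _ (fun s : R => flux q / s)).
      * assert (E : Derive (fun s : R => flux q / s) r = - flux q / (r * r))
          by (apply is_derive_unique; auto_derive; [ lra | field; lra ]).
        rewrite E; field; lra.
      * apply Hloc; intros s Hs; destruct (Hdens s) as (_ & Hps & _); [ lra | ].
        field; lra.
    + assert (Hb : is_derive (fun s =>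
        / 2 * (flux q / (s * dens s) * (flux q / (s * dens s))
               + swirl q / s * (swirl q / s)) + enthalpy q (dens s)) r
        (/ 2 * (2 * (flux q / (r * dens r))
                  * (- flux q * (dens r + r * ddens r) * / ((r * dens r) * (r * dens r)))
                + 2 * (swirl q / r) * (- swirl q / (r * r)))
         + ddens r * ((gam q - 1) * enthalpy q (dens r) / dens r))).
      { apply (is_derive_plus (fun s =>
          / 2 * (flux q / (s * dens s) * (flux q / (s * dens s))
               + swirl q / s * (swirl q / s))) (fun s => enthalpy q (dens s))).
        - apply (is_derive_scal (fun s => flux q / (s * dens s) * (flux q / (s * dens s))
               + swirl q / s * (swirl q / s))).
          apply (is_derive_plus
            (fun s => flux q / (s * dens s) * (flux q / (s * dens s)))
            (fun s => swirl q / s * (swirl q / s)));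
          [ exact (is_derive_square (fun s => flux q / (s * dens s)) _ _ D1)
          | exact (is_derive_square (fun s => swirl q / s) _ _ D2) ].
        - apply (is_derive_comp (enthalpy q) dens); [ | easy ].
          now apply is_derive_enthalpy. }
      assert (H0 : is_derive (fun s =>
        / 2 * (flux q / (s * dens s) * (flux q / (s * dens s))
               + swirl q / s * (swirl q / s)) + enthalpy q (dens s)) r 0).
      { apply (is_derive_ext_loc (fun _ => energy q));
          [ | apply (is_derive_const (energy q)) ].
        apply Hloc; intros s Hs; destruct (Hdens s) as (_ & _ & Hbs); [ lra | ].
        unfold bernoulli in Hbs; change (@eq R (energy q)
          (/ 2 * (flux q / (s * dens s) * (flux q / (s * dens s))
               + swirl q / s * (swirl q / s)) + enthalpy q (dens s))).
        rewrite <- Hbs; ring. }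
      apply is_derive_unique in Hb; apply is_derive_unique in H0.
      rewrite Hb in H0; apply eq_trans with (2 := H0).
      unfold enthalpy; destruct Hq; field; repeat split; lra.
    + field; lra.
    + rewrite Derive_const; ring.
Qed.

(** * The sonic density and the flow regimes *)

(** At a sonic point [(gamma - 1) * enthalpy] equals
    [c ^ 2 = 2 * (energy - enthalpy)], which determines the enthalpy. *)
Definition sonic_density (q : invariants) : R :=
  density_of_enthalpy q (2 * energy q / (gam q + 1)).

Lemma enthalpy_sonic_density q :
  admissible q ->
  0 < sonic_density q /\
  enthalpy q (sonic_density q) = 2 * energy q / (gam q + 1).
Proof.
  intros Hq; apply density_of_enthalpyK; [ easy | ].
  destruct Hq as (Hg & _ & _ & Hb); apply Rdiv_lt_0_compat; lra.
Qed.

Lemma physical_sonic_density q : admissible q -> physical q (sonic_density q).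
Proof.
  intros Hq; destruct (enthalpy_sonic_density q Hq) as [Hp He].
  split; [ easy | rewrite He ].
  destruct Hq as (Hg & _ & _ & Hb).
  apply Rmult_lt_reg_r with (gam q + 1); [ lra | ].
  replace (2 * energy q / (gam q + 1) * (gam q + 1)) with (2 * energy q)
    by (field; lra).
  nra.
Qed.

(** At the sonic density [c ^ 2 = U1 ^ 2 + U2 ^ 2], so the sonic gap is a
    nonnegative multiple of [U2 ^ 2]; it vanishes at [ds] and increases. *)
Lemma limiting_le_sonic_density q ds :
  admissible q -> limiting_density q ds -> ds <= sonic_density q.
Proof.
  intros Hq [[Hp _] Hs]; destruct (enthalpy_sonic_density q Hq) as [Hc He].
  apply Rnot_lt_le; intros Hlt.
  apply (sonic_gap_increasing q) in Hlt; trivial; rewrite Hs in Hlt.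
  assert (E : sonic_gap q (sonic_density q) =
    swirl q ^ 2 * sonic_density q ^ 2
      * ((gam q - 1) * (2 * energy q / (gam q + 1)))).
  { unfold sonic_gap; rewrite He; destruct Hq; field; lra. }
  assert (0 <= sonic_gap q (sonic_density q)); [ | lra ].
  destruct Hq as (Hg & _ & _ & Hb); rewrite E.
  apply Rmult_le_pos; apply Rmult_le_pos;
    try apply pow2_ge_0; try lra.
  left; apply Rdiv_lt_0_compat; lra.
Qed.

Lemma sound_speed_sq_enthalpy q d :
  admissible q ->
  sound_speed_sq (gam q) d (entropy q) = (gam q - 1) * enthalpy q d.
Proof.
  intros (Hg & _); unfold sound_speed_sq, enthalpy; field; lra.
Qed.

(** Bernoulli's law gives
    [M ^ 2 = 2 * (energy - enthalpy) / ((gamma - 1) * enthalpy)], which decreases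
    as the enthalpy, hence the density, increases. *)
Lemma flow_regime q w r :
  admissible q -> 0 < rho w r -> reduced_at q w r ->
  (subsonic_at (gam q) w r <-> sonic_density q < rho w r) /\
  (supersonic_at (gam q) w r <-> rho w r < sonic_density q) /\
  (sonic_at (gam q) w r <-> rho w r = sonic_density q).
Proof.
  intros Hq Hrho (E1 & E2 & E3 & Hb).
  destruct (enthalpy_sonic_density q Hq) as [Hc Hce].
  assert (H1 := enthalpy_lt_iff q (rho w r) (sonic_density q) Hq Hrho Hc).
  assert (H2 := enthalpy_lt_iff q (sonic_density q) (rho w r) Hq Hc Hrho).
  assert (Hh := enthalpy_pos q (rho w r) Hq).
  assert (Hg : 1 < gam q) by apply Hq.
  set (h := enthalpy q (rho w r)) in *.
  assert (Hm : flow_mach_sq (gam q) w r = 2 * (energy q - h) / ((gam q - 1) * h)).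
  { unfold flow_mach_sq, mach_sq, mach1_sq, mach2_sq.
    rewrite E3, sound_speed_sq_enthalpy by easy; fold h.
    unfold bernoulli in Hb; rewrite <- E1, <- E2 in Hb; fold h in Hb.
    rewrite <- Hb; field; lra. }
  assert (Hgh : 0 < (gam q - 1) * h) by (apply Rmult_lt_0_compat; lra).
  assert (Hex : flow_mach_sq (gam q) w r - 1
    = (enthalpy q (sonic_density q) - h) * ((gam q + 1) / ((gam q - 1) * h))).
  { rewrite Hm, Hce; field; lra. }
  assert (Hf : 0 < (gam q + 1) / ((gam q - 1) * h))
    by (apply Rdiv_lt_0_compat; lra).
  set (f := (gam q + 1) / ((gam q - 1) * h)) in *.
  unfold subsonic_at, supersonic_at, sonic_at.
  set (m := flow_mach_sq (gam q) w r) in *.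
  assert (Htri : (rho w r < sonic_density q /\ m > 1) \/
                 (rho w r = sonic_density q /\ m = 1) \/
                 (sonic_density q < rho w r /\ m < 1)).
  { destruct (Rtotal_order (rho w r) (sonic_density q)) as [H|[H|H]].
    - left; split; [ easy | ]; apply H1 in H.
      assert (0 < (enthalpy q (sonic_density q) - h) * f)
        by (apply Rmult_lt_0_compat; lra); lra.
    - right; left; split; [ easy | ].
      assert (h = enthalpy q (sonic_density q)) as Hx by (unfold h; now rewrite H).
      rewrite <- Hx in Hex; lra.
    - right; right; split; [ easy | ]; apply H2 in H.
      assert (0 < (h - enthalpy q (sonic_density q)) * f)
        by (apply Rmult_lt_0_compat; lra); lra. }
  lra.
Qed.

(** * The incoming state *)

Lemma inflow_bernoulli gamma r1 rho0 A0 U10 U20 :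
  gamma > 1 -> r1 > 0 -> rho0 > 0 ->
  bernoulli (inflow_invariants gamma r1 rho0 A0 U10 U20) r1 rho0.
Proof.
  intros; unfold bernoulli, enthalpy; simpl; unfold kappa1, kappa2, B0.
  field; lra.
Qed.

Lemma inflow_sonic_gap gamma r1 rho0 A0 U10 U20 :
  gamma > 1 ->
  sonic_gap (inflow_invariants gamma r1 rho0 A0 U10 U20) rho0
  = r1 ^ 2 * rho0 ^ 2 * (U10 ^ 2 + U20 ^ 2)
    * (sound_speed_sq gamma rho0 A0 - U10 ^ 2).
Proof.
  intros; unfold sonic_gap, enthalpy, sound_speed_sq; simpl.
  unfold kappa1, kappa2, B0; field; lra.
Qed.

Lemma r_c_sonic gamma r1 rho0 A0 U10 U20 :
  gamma > 1 -> r1 > 0 -> rho0 > 0 -> A0 > 0 -> U10 < 0 ->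
  let q := inflow_invariants gamma r1 rho0 A0 U10 U20 in
  r_c gamma r1 rho0 A0 U10 U20 = sqrt (radius_sq q (sonic_density q)).
Proof.
  intros Hg Hr1 Hrho HA HU q.
  assert (Hq : admissible q) by now apply inflow_admissible.
  destruct (enthalpy_sonic_density q Hq) as [Hc Hce].
  unfold r_c; cbv zeta; f_equal.
  assert (E : rho_c gamma rho0 A0 U10 U20 = sonic_density q).
  { unfold rho_c, sonic_density, density_of_enthalpy; simpl; f_equal.
    field; repeat split; lra. }
  rewrite E; unfold radius_sq; rewrite Hce.
  assert (Hb : 0 < energy q) by apply Hq.
  simpl in *; field; repeat split; try lra.
  apply Rgt_not_eq; nra.
Qed.

(** * Existence and uniqueness *)

Lemma solution_density gamma r1 rho0 A0 U10 U20 r0 w :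
  gamma > 1 -> rho0 > 0 -> A0 > 0 -> U10 < 0 -> 0 < r0 < r1 ->
  smooth_solution gamma r1 rho0 A0 U10 U20 r0 w ->
  let q := inflow_invariants gamma r1 rho0 A0 U10 U20 in
  forall r, r0 <= r <= r1 ->
    reduced_at q w r /\ physical q (rho w r) /\ radius_sq q (rho w r) = r ^ 2.
Proof.
  intros Hg Hrho HA HU Hr0 Hsol q r Hr.
  assert (Hred : reduced_at q w r) by (eapply first_integrals; eauto).
  assert (Hq : admissible q) by (apply inflow_admissible; lra).
  destruct Hsol as (_ & Hpos & _).
  split; [ easy | ]; apply bernoulli_iff.
  - lra.
  - apply Hpos, Hr.
  - apply Hq.
  - apply Hred.
Qed.

(** To change sides between [r] and [r1] the density would have to equal [ds] at
    some [s >= r].  Then [s ^ 2 = radius_sq q ds <= r0 ^ 2] forces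
    [s = r = r0], and the density at [r] is [ds], which lies on both sides. *)
Lemma solution_stays_on_branch gamma r1 rho0 A0 U10 U20 r0 w ds :
  gamma > 1 -> rho0 > 0 -> A0 > 0 -> U10 < 0 -> 0 < r0 < r1 ->
  let q := inflow_invariants gamma r1 rho0 A0 U10 U20 in
  limiting_density q ds -> radius_sq q ds <= r0 ^ 2 ->
  smooth_solution gamma r1 rho0 A0 U10 U20 r0 w ->
  forall r, r0 <= r <= r1 ->
    (ds <= rho w r /\ ds <= rho0) \/ (rho w r <= ds /\ rho0 <= ds).
Proof.
  intros Hg Hrho HA HU Hr0 q Hl Hsharp Hsol r Hr.
  assert (Hden := solution_density _ _ _ _ _ _ _ _ Hg Hrho HA HU Hr0 Hsol).
  fold q in Hden; cbv zeta in Hden.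
  destruct Hsol as ((_ & _ & (_ & Hc) & _) & _ & _ & Hr1 & _).
  pose (F := fun s => rho w (clamp r0 r1 s)).
  assert (HFr : F r = rho w r) by (unfold F; now rewrite clamp_id).
  assert (HF1 : F r1 = rho0) by (unfold F; rewrite clamp_id; [ easy | lra ]).
  destruct (Rle_or_lt ds (rho w r)) as [H|H];
    destruct (Rle_or_lt ds rho0) as [H'|H']; try lra.
  all: assert (Hcross : exists s, r <= s <= r1 /\ F s = ds).
  1,3: destruct (IVT_gen F r r1 ds) as [s [Hs Hv]];
    [ intros x; apply continuity_pt_filterlim;
      apply (continuous_clamped r0 r1 (rho w)); [ lra | exact Hc ]
    | rewrite HFr, HF1; unfold Rmin, Rmax; destruct (Rle_dec _ _); lra
    | exists s; rewrite Rmin_left, Rmax_right in Hs by lra; easy ].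
  all: destruct Hcross as [s [Hs Hv]]; unfold F in Hv;
    rewrite clamp_id in Hv by lra;
    destruct (Hden s) as (_ & _ & Hrs); [ lra | ];
    rewrite Hv in Hrs;
    destruct (Rle_lt_or_eq_dec r s) as [Hlt|Heq]; [ lra | | subst; lra ];
    assert (r0 ^ 2 < s ^ 2) by (simpl; nra); lra.
Qed.

Lemma solution_exists gamma r1 rho0 A0 U10 U20 r0 ds :
  gamma > 1 -> rho0 > 0 -> A0 > 0 -> U10 < 0 -> 0 < r0 < r1 ->
  let q := inflow_invariants gamma r1 rho0 A0 U10 U20 in
  limiting_density q ds -> rho0 <> ds -> radius_sq q ds <= r0 ^ 2 ->
  exists w, smooth_solution gamma r1 rho0 A0 U10 U20 r0 w.
Proof.
  intros Hg Hrho HA HU Hr0 q Hl Hne Hsharp.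
  assert (Hq : admissible q) by (apply inflow_admissible; lra).
  assert (Hb1 : bernoulli q r1 rho0) by (apply inflow_bernoulli; lra).
  apply bernoulli_iff in Hb1; [ | lra | lra | apply Hq ].
  destruct Hb1 as [Hp0 Hs0].
  destruct (density_branch q ds rho0 Hq Hl Hp0 Hne) as [dens [Hc Hd]].
  rewrite Hs0 in Hd.
  assert (Hsq : forall r, r0 <= r <= r1 -> radius_sq q ds <= r ^ 2 <= r1 ^ 2)
    by (intros r Hr; split; simpl in *; nra).
  assert (Hph : forall r, r0 <= r <= r1 -> physical q (dens (r ^ 2))).
  { intros r Hr; apply (physical_between q ds rho0); trivial; [ apply Hl | ].
    now apply Hd, Hsq. }
  assert (Hsqc : forall r, continuous (fun s : R => s ^ 2) r).
  { intros r; apply (ex_derive_continuous (fun s => s ^ 2)); auto_derive; easy. }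
  assert (Hdc : forall r, continuous (fun s => dens (s ^ 2)) r).
  { intros r; apply (continuous_comp (fun s => s ^ 2) dens); auto. }
  assert (Hgap : forall r, r0 < r < r1 -> sonic_gap q (dens (r ^ 2)) <> 0).
  { intros r Hr; apply (sonic_gap_neq0 q ds); trivial; [ apply Hph; lra | ].
    intros E; destruct (Hd (r ^ 2)) as [_ Hv]; [ apply Hsq; lra | ].
    rewrite E in Hv; simpl in *; nra. }
  destruct (reduced_flow_solves q r0 r1 (fun r => dens (r ^ 2))
              (fun r => density_slope q (dens (r ^ 2)) r)) as [Hsm He]; trivial.
  - lra.
  - intros r Hr; split; [ apply Hdc | ].
    split; [ now apply Hph | ].
    apply bernoulli_iff; [ lra | now apply Hph | apply Hq | ].
    split; [ now apply Hph | now apply Hd, Hsq ].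
  - intros r Hr; split.
    + apply is_derive_density_branch; auto.
      * apply (locally_interval _ (r ^ 2) (r0 ^ 2) (r1 ^ 2)); try (simpl; nra).
        intros y Hy1 Hy2; apply Hd; simpl in *; lra.
      * apply Hph; lra.
    + apply (continuous_density_slope q (fun s => dens (s ^ 2))); auto.
      apply Hph; lra.
  - exists (reduced_flow q (fun r => dens (r ^ 2))).
    assert (Hd1 : dens (r1 ^ 2) = rho0).
    { destruct (Hd (r1 ^ 2)) as [Hm Hv]; [ apply Hsq; lra | ].
      apply (radius_sq_injective q ds); trivial; [ apply Hph; lra | | lra ].
      unfold Rmin, Rmax in Hm; destruct (Rle_dec ds rho0); lra. }
    split; [ exact Hsm | split; [ | split; [ exact He | ] ] ].
    + intros r Hr; split; [ now apply Hph | simpl; lra ].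
    + unfold reduced_flow; cbn [rho U1 U2 A]; rewrite Hd1; simpl; unfold kappa1, kappa2.
      repeat split; field; lra.
Qed.

Lemma solution_unique gamma r1 rho0 A0 U10 U20 r0 ds w w' :
  gamma > 1 -> rho0 > 0 -> A0 > 0 -> U10 < 0 -> 0 < r0 < r1 ->
  let q := inflow_invariants gamma r1 rho0 A0 U10 U20 in
  limiting_density q ds -> rho0 <> ds -> radius_sq q ds <= r0 ^ 2 ->
  smooth_solution gamma r1 rho0 A0 U10 U20 r0 w ->
  smooth_solution gamma r1 rho0 A0 U10 U20 r0 w' -> agree_on r0 r1 w w'.
Proof.
  intros Hg Hrho HA HU Hr0 q Hl Hne Hsharp Hw Hw' r Hr.
  assert (Hq : admissible q) by (apply inflow_admissible; lra).
  destruct (solution_density _ _ _ _ _ _ _ _ Hg Hrho HA HU Hr0 Hw r Hr)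
    as ((E1 & E2 & E3 & _) & Hp & Hs).
  destruct (solution_density _ _ _ _ _ _ _ _ Hg Hrho HA HU Hr0 Hw' r Hr)
    as ((E1' & E2' & E3' & _) & Hp' & Hs').
  fold q in E1, E2, E3, Hp, Hs, E1', E2', E3', Hp', Hs'.
  assert (E : rho w r = rho w' r).
  { apply (radius_sq_injective q ds); trivial; [ | lra ].
    assert (B := solution_stays_on_branch _ _ _ _ _ _ _ _ _
                   Hg Hrho HA HU Hr0 Hl Hsharp Hw r Hr).
    assert (B' := solution_stays_on_branch _ _ _ _ _ _ _ _ _
                    Hg Hrho HA HU Hr0 Hl Hsharp Hw' r Hr).
    lra. }
  rewrite E1, E2, E3, E1', E2', E3', E; auto.
Qed.

(** * Classification of the flow patterns *)

Theorem theorem2p5 :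
  forall gamma r1 rho0 A0 U10 U20 : R,
  gamma > 1 -> r1 > 0 -> rho0 > 0 -> A0 > 0 -> U10 < 0 ->
  U10 ^ 2 <> gamma * A0 * Rpower rho0 (gamma - 1) ->
  let problem_II := smooth_solution gamma r1 rho0 A0 U10 U20 in
  let M1sq := mach1_sq gamma U10 rho0 A0 in
  let Msq := mach_sq gamma U10 U20 rho0 A0 in
  let rc := r_c gamma r1 rho0 A0 U10 U20 in
  exists r_sharp : R,
    0 < r_sharp < r1 /\
    (forall r0, 0 < r0 < r_sharp -> ~ exists w, problem_II r0 w) /\
    (forall r0, r_sharp <= r0 < r1 -> exists w, problem_II r0 w) /\
    (M1sq > 1 \/ (Msq > 1 /\ 1 > M1sq) ->
     forall r0, r_sharp <= r0 < r1 ->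
       exists_unique_flow r0 r1
         (fun w => problem_II r0 w /\ supersonic gamma r0 r1 w)) /\
    (Msq < 1 ->
     0 < rc < r1 /\
     forall r0, r_sharp <= r0 < r1 ->
       (r0 > rc ->
        exists_unique_flow r0 r1
          (fun w => problem_II r0 w /\ subsonic gamma r0 r1 w)) /\
       (r0 < rc ->
        exists_unique_flow r0 r1
          (fun w => problem_II r0 w /\ transonic gamma r0 r1 w)) /\
       (r0 = rc ->
        exists_unique_flow r0 r1
          (fun w => problem_II r0 w /\ subsonic_sonic gamma r0 r1 w) /\
        forall w, problem_II r0 w -> subsonic_sonic gamma r0 r1 w ->
          forall r, r0 <= r <= r1 -> (sonic_at gamma w r <-> r = rc))).
Proof.
  intros gamma r1 rho0 A0 U10 U20 Hg Hr1 Hrho HA HU Hne problem_II M1sq Msq rc.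
  set (q := inflow_invariants gamma r1 rho0 A0 U10 U20).
  assert (Hq : admissible q) by now apply inflow_admissible.
  destruct (limiting_density_exists q Hq) as [ds Hl].
  assert (Hds : 0 < ds) by apply Hl.
  set (dc := sonic_density q).
  assert (Hpc : physical q dc) by now apply physical_sonic_density.
  assert (Hsc : ds <= dc) by now apply limiting_le_sonic_density.
  assert (Hb1 : bernoulli q r1 rho0) by now apply inflow_bernoulli.
  apply bernoulli_iff in Hb1; [ | lra | lra | apply Hq ].
  destruct Hb1 as [Hp1 Hs1].
  set (c2 := sound_speed_sq gamma rho0 A0).
  assert (Hc2 : 0 < c2) by (unfold c2, sound_speed_sq;
    repeat apply Rmult_lt_0_compat; try lra; apply exp_pos).
  assert (Hgap : exists l, 0 < l /\ sonic_gap q rho0 = l * (c2 - U10 ^ 2)).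
  { exists (r1 ^ 2 * rho0 ^ 2 * (U10 ^ 2 + U20 ^ 2)); split.
    - assert (0 < U10 ^ 2) by (apply pow2_gt_0; lra).
      assert (0 <= U20 ^ 2) by apply pow2_ge_0.
      repeat apply Rmult_lt_0_compat; lra.
    - now apply inflow_sonic_gap. }
  destruct Hgap as [l [Hl0 Hgap]].
  assert (Hgapds : sonic_gap q ds = 0) by apply Hl.
  assert (Hside : (ds < rho0 -> U10 ^ 2 < c2) /\ rho0 <> ds).
  { split.
    - intros H; apply (sonic_gap_increasing q) in H; trivial; nra.
    - intros H; rewrite H, Hgapds in Hgap.
      symmetry in Hgap; apply Rmult_integral in Hgap.
      unfold c2, sound_speed_sq in Hgap; lra. }
  destruct Hside as (Hsub & Hneds).
  assert (Rs0 : 0 < radius_sq q ds) by (apply radius_sq_pos; [ easy | apply Hl ]).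
  assert (Rs1 : radius_sq q ds < r1 ^ 2)
    by (rewrite <- Hs1; apply radius_sq_min; trivial).
  set (rs := sqrt (radius_sq q ds)).
  assert (Hrs0 : 0 < rs) by now apply sqrt_lt_R0.
  assert (Hrs2 : rs ^ 2 = radius_sq q ds) by (apply pow2_sqrt; lra).
  assert (Hrc : rc = sqrt (radius_sq q dc)) by now apply r_c_sonic.
  assert (Rc0 : 0 < radius_sq q dc) by now apply radius_sq_pos.
  assert (Hrc0 : 0 < rc) by (rewrite Hrc; now apply sqrt_lt_R0).
  assert (Hrc2 : rc ^ 2 = radius_sq q dc) by (rewrite Hrc; apply pow2_sqrt; lra).
  assert (Hsqlt : forall x y, 0 < x -> 0 < y -> (x ^ 2 < y ^ 2 <-> x < y))
    by (intros x y Hx Hy; split; intros; simpl in *; nra).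
  assert (Hrs1 : rs < r1) by (apply Hsqlt; lra).
  assert (Hsharp : forall r0, rs <= r0 -> radius_sq q ds <= r0 ^ 2)
    by (intros r0 H; rewrite <- Hrs2; apply pow_incr; lra).
  assert (Hex : forall r0, rs <= r0 < r1 -> exists w, problem_II r0 w).
  { intros r0 Hr0; apply (solution_exists gamma r1 rho0 A0 U10 U20 r0 ds);
      trivial; [ lra | apply Hsharp; lra ]. }
  (* Uniqueness holds within all smooth solutions, so each regime claim only
     asks that an arbitrary solution be in that regime. *)
  assert (Huniq : forall r0 (P : flow -> Prop), rs <= r0 < r1 ->
    (forall w, problem_II r0 w -> P w) ->
    exists_unique_flow r0 r1 (fun w => problem_II r0 w /\ P w)).
  { intros r0 P Hr0 HP; destruct (Hex r0 Hr0) as [w Hw].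
    exists w; split; [ auto | ].
    intros w' [Hw' _].
    apply (solution_unique gamma r1 rho0 A0 U10 U20 r0 ds);
      trivial; [ lra | apply Hsharp; lra ]. }
  assert (Hreg : forall r0 w, rs <= r0 < r1 -> problem_II r0 w ->
    forall r, r0 <= r <= r1 ->
      ((ds <= rho w r /\ ds <= rho0) \/ (rho w r <= ds /\ rho0 <= ds)) /\
      physical q (rho w r) /\ radius_sq q (rho w r) = r ^ 2 /\
      (subsonic_at gamma w r <-> dc < rho w r) /\
      (supersonic_at gamma w r <-> rho w r < dc) /\
      (sonic_at gamma w r <-> rho w r = dc)).
  { intros r0 w Hr0 Hw r Hr.
    assert (Hr0' : 0 < r0 < r1) by lra.
    destruct (solution_density _ _ _ _ _ _ _ _ Hg Hrho HA HU Hr0' Hw r Hr)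
      as (Hred & Hp & Hs).
    split; [ | split; [ exact Hp | split; [ exact Hs | ] ] ].
    - apply (solution_stays_on_branch gamma r1 rho0 A0 U10 U20 r0 w ds); trivial.
      apply Hsharp; lra.
    - apply (flow_regime q w r); trivial; apply Hp. }
  (* At the inflow the Mach number is that of any flow with the given data. *)
  assert (Hin : (Msq > 1 <-> rho0 < dc) /\ (Msq < 1 <-> dc < rho0)).
  { destruct (Hex rs) as [w Hw]; [ lra | ].
    destruct (Hreg rs w) with (r := r1) as (_ & _ & _ & H1 & H2 & _); trivial; try lra.
    destruct Hw as (_ & _ & _ & W1 & W2 & W3 & W4).
    unfold subsonic_at, supersonic_at, flow_mach_sq in H1, H2.
    rewrite W1, W2, W3, W4 in H1, H2; split; assumption. }
  destruct Hin as [Hin1 Hin2].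
  exists rs; split; [ easy | split; [ | split; [ exact Hex | split ] ] ].
  - intros r0 Hr0 [w Hw].
    assert (Hr0' : 0 < r0 < r1) by lra.
    destruct (solution_density _ _ _ _ _ _ _ _ Hg Hrho HA HU Hr0' Hw r0)
      as (_ & Hp & Hs); [ lra | ].
    fold q in Hp, Hs.
    assert (r0 ^ 2 < rs ^ 2) by (apply Hsqlt; lra).
    destruct (Req_dec (rho w r0) ds) as [E|E]; [ rewrite E in Hs; lra | ].
    apply (radius_sq_min q ds) in E; trivial; lra.
  - intros Hcase r0 Hr0; apply Huniq; [ easy | ].
    intros w Hw r Hr.
    destruct (Hreg r0 w Hr0 Hw r) as (Hbr & Hp & Hs & _ & Hsu & _); [ lra | ].
    apply Hsu.
    assert (Hrlo : rs ^ 2 < r ^ 2) by (apply Hsqlt; lra).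
    assert (Hrhi : r ^ 2 < r1 ^ 2) by (apply Hsqlt; lra).
    destruct (Rtotal_order rho0 ds) as [H0|[H0|H0]]; [ | easy | ].
    + destruct (Req_dec (rho w r) ds) as [E|E]; [ rewrite E in Hs; lra | lra ].
    + assert (HM : M1sq < 1).
      { apply Hsub in H0; unfold M1sq, mach1_sq; fold c2.
        apply Rmult_lt_reg_r with c2; [ easy | ].
        replace (U10 ^ 2 / c2 * c2) with (U10 ^ 2) by (field; lra); lra. }
      assert (rho0 < dc) by (apply Hin1; lra).
      assert (rho w r < rho0); [ | lra ].
      apply (radius_sq_lt_iff q ds); trivial; lra.
  - intros HM; apply Hin2 in HM.
    assert (Hcmp : forall r0 w, rs <= r0 < r1 -> problem_II r0 w ->
      forall r, r0 <= r <= r1 ->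
        (rho w r < dc <-> r < rc) /\ (dc < rho w r <-> rc < r)).
    { intros r0 w Hr0 Hw r Hr.
      destruct (Hreg r0 w Hr0 Hw r Hr) as (Hbr & Hp & Hs & _).
      assert (Hb : ds <= rho w r) by lra.
      rewrite <- (Hsqlt r rc), <- (Hsqlt rc r), <- Hs, Hrc2 by lra.
      rewrite !(radius_sq_lt_iff q ds) by trivial; easy. }
    split.
    { split; [ easy | ]; apply Hsqlt; trivial.
      rewrite Hrc2, <- Hs1; apply (radius_sq_lt_iff q ds); trivial; lra. }
    assert (Hrc1 : rc < r1).
    { apply Hsqlt; trivial.
      rewrite Hrc2, <- Hs1; apply (radius_sq_lt_iff q ds); trivial; lra. }
    intros r0 Hr0; split; [ | split ].
    + intros Hr; apply Huniq; [ easy | ].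
      intros w Hw r Hrr.
      destruct (Hreg r0 w Hr0 Hw r) as (_ & _ & _ & H & _); [ lra | ].
      apply H, (Hcmp r0 w); trivial; lra.
    + intros Hr; apply Huniq; [ easy | ].
      intros w Hw; split.
      * exists ((rc + r1) / 2); split; [ lra | ].
        destruct (Hreg r0 w Hr0 Hw ((rc + r1) / 2)) as (_ & _ & _ & H & _); [ lra | ].
        apply H, (Hcmp r0 w); trivial; lra.
      * exists ((r0 + rc) / 2); split; [ lra | ].
        destruct (Hreg r0 w Hr0 Hw ((r0 + rc) / 2)) as (_ & _ & _ & _ & H & _);
          [ lra | ].
        apply H, (Hcmp r0 w); trivial; lra.
    + intros Hr.
      assert (Hson : forall w, problem_II r0 w -> forall r, r0 <= r <= r1 ->
                (sonic_at gamma w r <-> r = rc)).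
      { intros w Hw r Hrr.
        destruct (Hreg r0 w Hr0 Hw r Hrr) as (_ & _ & _ & _ & _ & H).
        destruct (Hcmp r0 w Hr0 Hw r Hrr) as [C1 C2].
        rewrite H; split; intros E.
        - destruct (Rtotal_order r rc) as [T|[T|T]]; [ | easy | ];
            [ apply C1 in T | apply C2 in T ]; lra.
        - destruct (Rtotal_order (rho w r) dc) as [T|[T|T]]; [ | easy | ];
            [ apply C1 in T | apply C2 in T ]; lra. }
      split; [ | intros w Hw _; now apply Hson ].
      apply Huniq; [ easy | ].
      intros w Hw; split.
      * intros r Hrr.
        destruct (Hreg r0 w Hr0 Hw r) as (_ & _ & _ & H & _); [ lra | ].
        apply H, (Hcmp r0 w); trivial; lra.
      * apply Hson; trivial; lra.
Qed.
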